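(* Suppose that each $f_i:\mathbb{R}^d\to\mathbb{R}$, $i=1,\dots,n$, is $L$-smooth for some $L>0$, and that $f=\frac1n\sum_{i=1}^nf_i$ is $\mu$-strongly convex for some $\mu>0$. For DHPL-Katyusha with the RandK compressor, the efficient Lipschitz constant is less than $$\widetilde L_{Rand}=\left(\frac d{nK}+1\right)L.$$
   Context: Smoothness: $f_i$ is $L$-smooth if $f_i(y)\le f_i(x)+\langle\nabla f_i(x),y-x\rangle+\frac L2\|y-x\|^2$ for all $x,y\in\mathbb{R}^d$. Strong convexity: $f(y)\ge f(x)+\langle\nabla f(x),y-x\rangle+\frac\mu2\|y-x\|^2$ for all $x,y\in\mathbb{R}^d$. RandK compressor: $Q(x)=\frac dK\sum_{l\in S}x_le_l$ where $S\subset\{1,\dots,d\}$ is a uniformly random subset of size $K$; it is unbiased and satisfies $\mathbb{E}\|Q(x)\|^2\le\omega\|x\|^2$ with $\omega=\frac dK$. The compressors $Q_1,\dots,Q_n$ of the workers are independent copies, drawn afresh each iteration. DHPL-Katyusha: parameters $\theta_1,\theta_2\in\mathbb{R}$, $p\in(0,1]$, $\Lambda=L\frac{\omega}{n}$, $\sigma=\frac\mu\Lambda$, $\eta=\min\left\{\frac{\theta_2}{(1+\theta_2)\theta_1},\frac{\frac{\Lambda}{L}\theta_2}{(1+\theta_2)\theta_1}\right\}$. Start with $y^0=w^0=z^0\in\mathbb{R}^d$. For $k=0,1,2,\dots$: $x^k=\theta_1z^k+\theta_2w^k+(1-\theta_1-\theta_2)y^k$; $\widetilde g^k=\frac1n\sum_{i=1}^nQ_i(\nabla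 f_i(x^k)-\nabla f_i(w^k))+\nabla f(w^k)$; $z^{k+1}=\frac1{1+\eta\sigma}(\eta\sigma x^k+z^k-\frac\eta\Lambda\widetilde g^k)$; $y^{k+1}=x^k+\theta_1(z^{k+1}-z^k)$; $w^{k+1}=y^k$ with probability $p$, $w^{k+1}=w^k$ with probability $1-p$. Efficient Lipschitz constant: the smallest constant $\widetilde L$ such that $\mathbb{E}\|\widetilde g^k-\nabla f(x^k)\|^2\le2\widetilde L\bigl(f(w^k)-f(x^k)-\langle\nabla f(x^k),w^k-x^k\rangle\bigr)$, where the expectation is over the randomness of the compressors given $x^k,w^k$.
   Formalization: Each f_i is additionally assumed convex (and differentiable): without convexity the claim fails, e.g. d=n=2, K=1, L=4, f_1=2|x|^2, f_2=-(3/2)|x|^2 gives constant 12.5 > 8. The smallest constant is taken among nonnegative reals. *)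

(* Defs.v *)
From HB Require Import structures.
From mathcomp Require Import all_boot all_order all_algebra.
From mathcomp Require Import all_classical all_reals all_analysis.
Import Order.TTheory GRing.Theory Num.Theory.
Import numFieldNormedType.Exports.

Set Implicit Arguments.
Unset Strict Implicit.
Unset Printing Implicit Defensive.

Local Open Scope ring_scope.

(* The library norm on 'rV[R]_d is the sup norm, so the Euclidean inner product
   and squared norm are introduced here. *)
Definition dotp {R : realType} {d : nat} (u v : 'rV[R]_d) : R :=
  \sum_(j < d) u 0 j * v 0 j.

Definition sqnorm {R : realType} {d : nat} (u : 'rV[R]_d) : R := dotp u u.

(* Vector of partial derivatives: this is the gradient of f at x whenever f is
   differentiable at x. *)
Definition grad {R : realType} {d : nat} (f : 'rV[R]_d -> R) (x : 'rV[R]_d)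
    : 'rV[R]_d :=
  \row_(j < d) 'D_(delta_mx 0 j) f x.

Definition bregman {R : realType} {d : nat} (f : 'rV[R]_d -> R)
    (y x : 'rV[R]_d) : R :=
  f y - f x - dotp (grad f x) (y - x).

Definition smooth {R : realType} {d : nat} (L : R) (f : 'rV[R]_d -> R) : Prop :=
  forall x y, f y <= f x + dotp (grad f x) (y - x) + L / 2 * sqnorm (y - x).

(* mu = 0 gives convexity, for differentiable f. *)
Definition strongly_convex {R : realType} {d : nat} (mu : R)
    (f : 'rV[R]_d -> R) : Prop :=
  forall x y, f x + dotp (grad f x) (y - x) + mu / 2 * sqnorm (y - x) <= f y.

Definition average {R : realType} {n d : nat} (f : 'I_n -> 'rV[R]_d -> R)
    (x : 'rV[R]_d) : R :=
  n%:R^-1 * \sum_(i < n) f i x.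

Definition randk_omega (R : realType) (d K : nat) : R := d%:R / K%:R.

Definition randk {R : realType} {d : nat} (K : nat) (S : {set 'I_d})
    (x : 'rV[R]_d) : 'rV[R]_d :=
  (d%:R / K%:R) *: \sum_(l in S) x 0 l *: delta_mx 0 l.

Definition randk_prob (R : realType) {d : nat} (K : nat) (S : {set 'I_d}) : R :=
  if #|S| == K then 'C(d, K)%:R^-1 else 0.

(* Joint law of the index sets drawn by the n workers in one iteration: the
   draws are independent, so it is a product. *)
Definition workers_prob (R : realType) {n d : nat} (K : nat)
    (S : {ffun 'I_n -> {set 'I_d}}) : R :=
  \prod_(i < n) randk_prob R K (S i).

Definition workers_expect {R : realType} {n d : nat} (K : nat)
    (X : {ffun 'I_n -> {set 'I_d}} -> R) : R :=
  \sum_S workers_prob R K S * X S.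

Definition grad_estimator {R : realType} {n d : nat}
    (f : 'I_n -> 'rV[R]_d -> R) (K : nat) (S : {ffun 'I_n -> {set 'I_d}})
    (x w : 'rV[R]_d) : 'rV[R]_d :=
  n%:R^-1 *: \sum_(i < n) randk K (S i) (grad (f i) x - grad (f i) w)
  + grad (average f) w.

Record dhpl_params (R : realType) := DhplParams {
  smoothness : R;             (* L *)
  strong_convexity : R;       (* mu *)
  theta1 : R;
  theta2 : R;
  refresh_prob : R;           (* p *)
  sparsity : nat              (* K *)
}.

Definition dhpl_Lambda {R : realType} (n d : nat) (P : dhpl_params R) : R :=
  smoothness P * (randk_omega R d (sparsity P) / n%:R).

Definition dhpl_sigma {R : realType} (n d : nat) (P : dhpl_params R) : R :=
  strong_convexity P / dhpl_Lambda n d P.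

(* Division is total (x / 0 = 0), so the step size also has a (meaningless)
   value when theta1 = 0 or theta2 = -1; nothing below excludes these cases. *)
Definition dhpl_eta {R : realType} (n d : nat) (P : dhpl_params R) : R :=
  Num.min (theta2 P / ((1 + theta2 P) * theta1 P))
    (dhpl_Lambda n d P / smoothness P * theta2 P
     / ((1 + theta2 P) * theta1 P)).

Record dhpl_state (R : realType) (d : nat) := DhplState {
  state_y : 'rV[R]_d;
  state_z : 'rV[R]_d;
  state_w : 'rV[R]_d
}.

Definition state_x {R : realType} {d : nat} (P : dhpl_params R)
    (s : dhpl_state R d) : 'rV[R]_d :=
  theta1 P *: state_z s + theta2 P *: state_w s
  + (1 - theta1 P - theta2 P) *: state_y s.

Definition dhpl_draw (n d : nat) : Type :=
  ({ffun 'I_n -> {set 'I_d}} * bool)%type.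

Definition draw_prob {R : realType} {n d : nat} (P : dhpl_params R)
    (xi : dhpl_draw n d) : R :=
  workers_prob R (sparsity P) xi.1
  * (if xi.2 then refresh_prob P else 1 - refresh_prob P).

Definition dhpl_step {R : realType} {n d : nat} (f : 'I_n -> 'rV[R]_d -> R)
    (P : dhpl_params R) (xi : dhpl_draw n d) (s : dhpl_state R d)
    : dhpl_state R d :=
  let eta := dhpl_eta n d P in
  let sigma := dhpl_sigma n d P in
  let x := state_x P s in
  let g := grad_estimator f (sparsity P) xi.1 x (state_w s) in
  let z' := (1 + eta * sigma)^-1 *:
    ((eta * sigma) *: x + state_z s - (eta / dhpl_Lambda n d P) *: g) in
  let y' := x + theta1 P *: (z' - state_z s) in
  let w' := if xi.2 then state_y s else state_w s in
  DhplState y' z' w'.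

Fixpoint dhpl_run {R : realType} {n d : nat} (f : 'I_n -> 'rV[R]_d -> R)
    (P : dhpl_params R) (y0 : 'rV[R]_d) (xi : nat -> dhpl_draw n d) (k : nat)
    : dhpl_state R d :=
  if k is k'.+1 then dhpl_step f P (xi k') (dhpl_run f P y0 xi k')
  else DhplState y0 y0 y0.

(* C is admissible if the inequality holds at every iteration of every run.  A
   run is given by its starting point and a sequence of draws, each of positive
   probability (all laws are discrete).  The compressors of iteration k are
   drawn afresh, hence the expectation over them given x^k and w^k is the one
   under workers_prob with x^k and w^k held fixed. *)
Definition estimator_bound {R : realType} {n d : nat}
    (f : 'I_n -> 'rV[R]_d -> R) (P : dhpl_params R) (C : R) : Prop :=
  forall (y0 : 'rV[R]_d) (xi : nat -> dhpl_draw n d),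
    (forall k, 0 < draw_prob P (xi k)) ->
  forall k,
    let s := dhpl_run f P y0 xi k in
    let x := state_x P s in
    let w := state_w s in
    workers_expect (sparsity P)
      (fun S => sqnorm (grad_estimator f (sparsity P) S x w
                        - grad (average f) x))
    <= 2 * C * bregman (average f) w x.

(* The constraint 0 <= C only matters when x^k = w^k at every iteration of
   every run (for instance if theta2 = 0): both sides of the inequality then
   vanish and every real C, however negative, satisfies it.  In all other cases
   strong convexity of the average forces C >= 0. *)
Definition efficient_lipschitz {R : realType} {n d : nat}
    (f : 'I_n -> 'rV[R]_d -> R) (P : dhpl_params R) (C : R) : Prop :=
  [/\ 0 <= C, estimator_bound f P C
    & forall C', 0 <= C' -> estimator_bound f P C' -> C <= C'].

(* Main.v *)
Require Import Defs.
From mathcomp Require Import all_boot all_order all_algebra.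
From mathcomp Require Import all_classical all_reals all_analysis.
From mathcomp Require Import ring lra.
Import Order.TTheory GRing.Theory Num.Theory.
Import numFieldNormedType.Exports.
Local Open Scope ring_scope.

(** The estimator [grad_estimator f K S x w] is unbiased for the gradient of
    the average at [x], and its error is the mean of the [n] independent
    centred vectors [Q_i(v_i) - v_i], with
    [v_i = grad (f i) x - grad (f i) w].  A fixed coordinate survives the
    random sparsification with probability [K / d], so each coordinate of
    [Q(v) - v] has variance [(omega - 1) v_l ^ 2] with [omega = d / K].
    Variances of independent centred variables add up, hence the exact formula
    [workers_expect_sq_error]: the mean squared error equals
    [(omega - 1) / n ^ 2] times the sum of the [sqnorm v_i].

    Convexity and smoothness of [f i] give
    [sqnorm v_i <= 2 L bregman (f i) w x] ([sqnorm_gradB_le_bregman]), and the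
    Bregman divergences average to that of the average of the [f i].  So
    [(omega - 1) / n * L] is an admissible constant; it is nonnegative because
    [K <= d], and it is smaller than [(omega / n + 1) L].

    A smallest admissible constant exists because the admissible nonnegative
    constants form a nonempty closed half-line: each constraint reads
    [a <= 2 C b] with [b >= 0] ([efficient_lipschitz_exists]). *)

(** * Euclidean geometry and gradients *)

Section Geometry.
Context {R : realType} {d : nat}.
Implicit Types (u v w x y : 'rV[R]_d) (f : 'rV[R]_d -> R).

Lemma dotpDr u v w : dotp u (v + w) = dotp u v + dotp u w.
Proof.
by rewrite /dotp -big_split; apply: eq_bigr => j _; rewrite mxE mulrDr.
Qed.

Lemma dotpBl u v w : dotp (u - v) w = dotp u w - dotp v w.
Proof.
by rewrite /dotp -sumrB; apply: eq_bigr => j _; rewrite !mxE mulrBl.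
Qed.

Lemma dotpZr a u v : dotp u (a *: v) = a * dotp u v.
Proof.
by rewrite /dotp mulr_sumr; apply: eq_bigr => j _; rewrite mxE mulrCA.
Qed.

Lemma dotpZl a u v : dotp (a *: u) v = a * dotp u v.
Proof.
by rewrite /dotp mulr_sumr; apply: eq_bigr => j _; rewrite mxE mulrA.
Qed.

Lemma dotp_suml (I : finType) (u : I -> 'rV[R]_d) v :
  dotp (\sum_i u i) v = \sum_i dotp (u i) v.
Proof.
rewrite /dotp exchange_big; apply: eq_bigr => j _.
by rewrite summxE mulr_suml.
Qed.

Lemma sqnormZ a u : sqnorm (a *: u) = a ^+ 2 * sqnorm u.
Proof. by rewrite /sqnorm dotpZl dotpZr mulrA. Qed.

Lemma sqnorm_ge0 u : 0 <= sqnorm u.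
Proof. by apply: sumr_ge0 => j _; rewrite -expr2 sqr_ge0. Qed.

Lemma bregman_ge0 mu f y x : 0 <= mu -> strongly_convex mu f ->
  0 <= bregman f y x.
Proof.
move=> mu0 /(_ x y) fxy; rewrite /bregman.
have : 0 <= mu / 2 * sqnorm (y - x) by rewrite mulr_ge0 ?sqnorm_ge0 ?divr_ge0.
lra.
Qed.

(** The divergence from [x] is nonnegative everywhere by convexity; a gradient
    step of length [1 / L] from [w] decreases it by at least
    [sqnorm (grad f x - grad f w) / (2 L)] by smoothness, so its value at [w]
    was at least that large. *)
Lemma sqnorm_gradB_le_bregman L f x w : 0 < L ->
  smooth L f -> strongly_convex 0 f ->
  sqnorm (grad f x - grad f w) <= 2 * L * bregman f w x.
Proof.
move=> L0 fL fc.
set v := grad f x - grad f w.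
have := bregman_ge0 0 f (w + L^-1 *: v) x (lexx 0) fc.
have := fL w (w + L^-1 *: v).
rewrite /bregman (_ : w + _ - w = L^-1 *: v); last by rewrite addrC addKr.
rewrite (_ : w + _ - x = (w - x) + L^-1 *: v); last by rewrite addrAC.
rewrite sqnormZ dotpDr !dotpZr.
have : dotp (grad f x) v - dotp (grad f w) v = sqnorm v by rewrite -dotpBl.
set a := dotp (grad f x) v; set b := dotp (grad f w) v.
set c := dotp _ (w - x); set s := sqnorm v => abs hL hc.
have : 0 <= f w - f x - c - L^-1 * (a - b) + L / 2 * (L^-1 ^+ 2 * s) by lra.
rewrite abs (_ : _ + _ = (2 * L * (f w - f x - c) - s) / (2 * L)).
  by rewrite pmulr_lge0 ?subr_ge0// invr_gt0 mulr_gt0.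
by field; rewrite gt_eqF.
Qed.

Lemma grad_average n (f : 'I_n -> 'rV[R]_d -> R) x :
  (forall i, differentiable (f i) x) ->
  grad (average f) x = n%:R^-1 *: \sum_i grad (f i) x.
Proof.
move=> df; apply/rowP => j; rewrite !mxE summxE.
have dv i : derivable (f i) x (delta_mx 0 j) by exact/diff_derivable.
have -> : average f = n%:R^-1 \*: (\sum_(i < n) f i).
  by apply/funext => y; rewrite /average /= fct_sumE.
rewrite deriveZ; last exact: derivable_sum.
rewrite derive_sum//; congr (_ * _).
by apply: eq_bigr => i _; rewrite mxE.
Qed.

Lemma bregman_average n (f : 'I_n -> 'rV[R]_d -> R) y x :
  (forall i, differentiable (f i) x) ->
  bregman (average f) y x = n%:R^-1 * \sum_i bregman (f i) y x.
Proof.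
move=> df; rewrite /bregman grad_average// dotpZl dotp_suml /average.
by rewrite -!mulrBr !sumrB.
Qed.

End Geometry.

(** * Independent draws *)

Section ProductLaw.
Context {R : comNzRingType} {I T : finType} (P : T -> R).

Lemma prod_law_expect_prod (G : I -> T -> R) :
  \sum_(S : {ffun I -> T}) (\prod_i P (S i)) * \prod_i G i (S i)
  = \prod_i \sum_t P t * G i t.
Proof.
rewrite bigA_distr_bigA; apply: eq_bigr => S _.
by rewrite -big_split.
Qed.

Hypothesis P1 : \sum_t P t = 1.

Lemma prod_law_covariance (X : I -> T -> R) (i k : I) :
  (forall i, \sum_t P t * X i t = 0) ->
  \sum_(S : {ffun I -> T}) (\prod_i P (S i)) * (X i (S i) * X k (S k))
  = if i == k then \sum_t P t * X i t ^+ 2 else 0.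
Proof.
move=> X0.
(* The product of two factors is a product over all indices of G m, where
   G m is 1 for m outside i and k. *)
pose G m t := (if m == i then X m t else 1) * (if m == k then X m t else 1).
under eq_bigr => S _.
  rewrite (_ : X i _ * _ = \prod_m G m (S m)); last first.
    by rewrite big_split -!big_mkcond !big_pred1_eq.
  over.
rewrite prod_law_expect_prod (bigD1 i)//= /G eqxx.
have [<-|ik] := eqVneq i k.
  rewrite [X in _ * X]big1 ?mulr1; first by apply: eq_bigr => t _.
  move=> m /negPf mi; rewrite -[RHS]P1; apply: eq_bigr => t _.
  by rewrite mi !mulr1.
under eq_bigr => t _ do rewrite mulr1.
by rewrite X0 mul0r.
Qed.

Lemma prod_law_variance (X : I -> T -> R) :
  (forall i, \sum_t P t * X i t = 0) ->
  \sum_(S : {ffun I -> T}) (\prod_i P (S i)) * (\sum_i X i (S i)) ^+ 2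
  = \sum_i \sum_t P t * X i t ^+ 2.
Proof.
move=> X0.
under eq_bigr => S _.
  rewrite expr2 big_distrlr mulr_sumr /=.
  under eq_bigr => i _ do rewrite mulr_sumr.
  over.
rewrite exchange_big; apply: eq_bigr => i _.
rewrite exchange_big (bigD1 i)//= (prod_law_covariance X i i X0) eqxx.
rewrite [X in _ + X]big1 ?addr0// => k ki.
by rewrite (prod_law_covariance X i k X0) eq_sym (negPf ki).
Qed.

End ProductLaw.

(** * Random sparsification *)

(** The sets of size [k + 1] avoiding [x] are those of a set with one element
    less, so Pascal's rule counts the ones containing [x]. *)
Lemma card_draws_mem (T : finType) (x : T) (k : nat) :
  #|[set S : {set T} | (#|S| == k.+1) && (x \in S)]| = 'C(#|T|.-1, k).
Proof.
set A := [set S : {set T} | _].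
have avoid : #|[set S : {set T} | #|S| == k.+1] :\: A| = 'C(#|T|.-1, k.+1).
  rewrite -(cardsC1 x) -cards_draws; apply: eq_card => S.
  rewrite !inE -finset.disjoints_subset disjoint_sym disjoints1.
  by case: eqP; rewrite ?andbT ?andbF.
have := cardsID A [set S : {set T} | #|S| == k.+1].
rewrite avoid card_draws (finset.setIidPr _); last first.
  by apply/fintype.subsetP => S; rewrite !inE => /andP[].
have : (0 < #|T|)%N by apply/card_gt0P; exists x.
by case: #|T| => // m _; rewrite binS /= addnC => /addnI.
Qed.

Section RandK.
Context {R : realType} {d : nat} (K : nat).
Hypotheses (K_gt0 : (0 < K)%N) (K_le_d : (K <= d)%N).

Let omega : R := d%:R / K%:R.

Let K_neq0 : K%:R != 0 :> R.
Proof. by rewrite pnatr_eq0 -lt0n. Qed.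

Let d_neq0 : d%:R != 0 :> R.
Proof. by rewrite pnatr_eq0 -lt0n (leq_trans K_gt0). Qed.

Let bin_neq0 : 'C(d, K)%:R != 0 :> R.
Proof. by rewrite pnatr_eq0 -lt0n bin_gt0. Qed.

Lemma randk_prob_sum : \sum_(S : {set 'I_d}) randk_prob R K S = 1.
Proof.
rewrite /randk_prob -big_mkcond sumr_const /= -[X in _ *+ X]cardsE.
by rewrite card_draws card_ord -[_ *+ _]mulr_natr mulVf.
Qed.

Lemma randk_prob_mem (l : 'I_d) :
  \sum_(S : {set 'I_d}) randk_prob R K S * (l \in S)%:R = omega^-1.
Proof.
transitivity (\sum_(S : {set 'I_d} | (#|S| == K) && (l \in S))
   'C(d, K)%:R^-1 : R).
  rewrite [RHS]big_mkcond; apply: eq_bigr => S _; rewrite /randk_prob.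
  by case: eqP; case: (l \in S); rewrite ?mulr1 ?mulr0 ?mul0r.
rewrite sumr_const -[X in _ *+ X]cardsE -[_ *+ _]mulr_natr /omega.
have -> : K = K.-1.+1 by rewrite prednK.
rewrite card_draws_mem card_ord.
have /(congr1 (fun m => m%:R : R)) := mul_bin_diag d K.-1.
rewrite prednK// !natrM => e; apply: (mulfI d_neq0).
rewrite mulrCA e; field; exact/and3P.
Qed.

Lemma randkE (S : {set 'I_d}) (v : 'rV[R]_d) j :
  randk K S v 0 j = omega * (j \in S)%:R * v 0 j.
Proof.
rewrite !mxE -mulrA summxE; congr (_ * _).
under eq_bigr => l _ do rewrite !mxE eqxx /=.
rewrite big_mkcond (bigD1 j)//= eqxx mulr1 big1 ?addr0.
  by case: ifP; rewrite ?mul1r ?mul0r.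
by move=> l lj; case: ifP; rewrite // eq_sym (negPf lj) mulr0.
Qed.

Lemma randk_mean (l : 'I_d) a :
  \sum_(S : {set 'I_d}) randk_prob R K S * ((omega * (l \in S)%:R - 1) * a)
  = 0.
Proof.
transitivity (a * (omega * (\sum_S randk_prob R K S * (l \in S)%:R)
                   - \sum_(S : {set 'I_d}) randk_prob R K S)).
  rewrite mulr_sumr -sumrB mulr_sumr; apply: eq_bigr => S _; ring.
rewrite randk_prob_mem randk_prob_sum mulfV ?subrr ?mulr0//.
by rewrite mulf_neq0 ?invr_eq0.
Qed.

Lemma randk_variance (l : 'I_d) a :
  \sum_(S : {set 'I_d})
    randk_prob R K S * ((omega * (l \in S)%:R - 1) * a) ^+ 2
  = (omega - 1) * a ^+ 2.
Proof.
transitivity (a ^+ 2 * ((omega ^+ 2 - 2 * omega)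
                   * (\sum_S randk_prob R K S * (l \in S)%:R)
                   + \sum_(S : {set 'I_d}) randk_prob R K S)).
  rewrite [_ * \sum_S _]mulr_sumr -big_split mulr_sumr.
  by apply: eq_bigr => S _; case: (l \in S); rewrite /=; ring.
rewrite randk_prob_mem randk_prob_sum; field.
by rewrite mulf_neq0 ?invr_eq0.
Qed.

(** The squared norm is a sum over coordinates, and each coordinate of the
    error is a sum over workers of independent centred variables, so the
    variances add up one coordinate at a time, even though the coordinates
    kept by one worker are dependent. *)
Lemma workers_expect_sq_error n (f : 'I_n -> 'rV[R]_d -> R) x w :
  (forall i y, differentiable (f i) y) ->
  workers_expect K
    (fun S => sqnorm (grad_estimator f K S x w - grad (average f) x))
  = (omega - 1) / n%:R ^+ 2 * \sum_i sqnorm (grad (f i) x - grad (f i) w).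
Proof.
move=> df; pose v i : 'rV[R]_d := grad (f i) x - grad (f i) w.
pose X j i (S : {set 'I_d}) := (omega * (j \in S)%:R - 1) * v i 0 j.
have errE S j : (grad_estimator f K S x w - grad (average f) x) 0 j
    = n%:R^-1 * \sum_i X j i (S i).
  rewrite /grad_estimator !grad_average// -addrA -scalerBr -scalerDr !mxE.
  congr (_ * _); rewrite !summxE -!sumrB -big_split; apply: eq_bigr => i _ /=.
  rewrite randkE /X /v !mxE; ring.
rewrite /workers_expect /workers_prob.
transitivity (\sum_j n%:R^-1 ^+ 2 *
    \sum_(S : {ffun 'I_n -> {set 'I_d}})
      (\prod_i randk_prob R K (S i)) * (\sum_i X j i (S i)) ^+ 2).
  under [RHS]eq_bigr => j _ do rewrite mulr_sumr.
  rewrite exchange_big; apply: eq_bigr => S _.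
  rewrite /sqnorm /dotp mulr_sumr; apply: eq_bigr => j _.
  by rewrite errE -expr2 exprMn mulrCA.
under eq_bigr => j _.
  rewrite (prod_law_variance _ randk_prob_sum); last first.
    by move=> i; exact: randk_mean.
  under eq_bigr => i _ do rewrite randk_variance.
  rewrite -mulr_sumr.
  over.
rewrite -mulr_sumr -mulr_sumr mulrA exchange_big exprVn [_^-1 * _]mulrC.
by congr (_ * _).
Qed.

End RandK.

(** * The efficient Lipschitz constant *)

Section Efficient.
Context {R : realType} {n d : nat}.

(** The infimum of the admissible nonnegative constants is itself admissible:
    a constraint [a <= 2 C b] with [b > 0] bounds all of them below by
    [a / (2 b)], and one with [b = 0] does not involve [C]. *)
Lemma efficient_lipschitz_exists (f : 'I_n -> 'rV[R]_d -> R)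
    (P : dhpl_params R) (C : R) :
  (forall y x, 0 <= bregman (average f) y x) ->
  0 <= C -> estimator_bound f P C ->
  exists2 Leff, efficient_lipschitz f P Leff & Leff <= C.
Proof.
move=> b0 C0 fC.
pose A := [set c : R | 0 <= c /\ estimator_bound f P c]%classic.
have lbA : has_lbound A by exists 0 => c [].
have A0 : (A !=set0)%classic by exists C.
exists (inf A); last exact: ge_inf.
split.
- by apply: lb_le_inf => // c [].
- move=> y0 xi xi_gt0 k /=.
  set x := state_x _ _; set w := state_w _.
  have [b_eq0|b_neq0] := eqVneq (bregman (average f) w x) 0.
    by have := fC y0 xi xi_gt0 k; rewrite /= -/x -/w b_eq0 !mulr0.
  have b_gt0 : 0 < 2 * bregman (average f) w x.
    by rewrite mulr_gt0// lt_def b_neq0 b0.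
  rewrite mulrAC mulrC -ler_pdivrMr//; apply: lb_le_inf => // c [_ fc].
  by rewrite ler_pdivrMr// mulrC mulrAC; exact: fc.
- by move=> c c0 fc; exact: ge_inf.
Qed.

End Efficient.

Theorem lemma3 (R : realType) (n d K : nat) (f : 'I_n -> 'rV[R]_d -> R)
    (L mu theta1 theta2 p : R)
    (n_gt0 : (0 < n)%N) (K_gt0 : (0 < K)%N) (K_le_d : (K <= d)%N)
    (L_gt0 : 0 < L) (mu_gt0 : 0 < mu) (p_gt0 : 0 < p) (p_le1 : p <= 1)
    (f_diff : forall i x, differentiable (f i) x)
    (f_smooth : forall i, smooth L (f i))
    (f_convex : forall i, strongly_convex 0 (f i))
    (avg_sconvex : strongly_convex mu (average f)) :
  exists Leff : R,
    efficient_lipschitz f (DhplParams L mu theta1 theta2 p K) Leff /\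
    Leff < (d%:R / (n%:R * K%:R) + 1) * L.
Proof.
have n0 : 0 < n%:R :> R by rewrite ltr0n.
have K0 : 0 < K%:R :> R by rewrite ltr0n.
have omega_ge1 : 0 <= d%:R / K%:R - 1 :> R.
  by rewrite subr_ge0 ler_pdivlMr// mul1r ler_nat.
pose C := (d%:R / K%:R - 1) / n%:R * L.
have [] := @efficient_lipschitz_exists R n d f
  (DhplParams L mu theta1 theta2 p K) C.
- by move=> y x; exact: bregman_ge0 mu _ _ _ (ltW mu_gt0) avg_sconvex.
- by rewrite mulr_ge0 ?(ltW L_gt0)// divr_ge0// ltW.
- move=> y0 xi _ k /=; set x := state_x _ _; set w := state_w _.
  rewrite workers_expect_sq_error// bregman_average//.
  rewrite (_ : 2 * C * _ = (d%:R / K%:R - 1) / n%:R ^+ 2 *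
      \sum_i 2 * L * bregman (f i) w x); last first.
    by rewrite -mulr_sumr /C; field; rewrite !gt_eqF.
  rewrite ler_wpM2l//; first by rewrite divr_ge0 ?sqr_ge0.
  by apply: ler_sum => i _; exact: sqnorm_gradB_le_bregman.
move=> Leff Leff_eff Leff_le; exists Leff; split=> //.
apply: le_lt_trans Leff_le _; rewrite ltr_pM2r// mulrBl mul1r.
rewrite [n%:R * _]mulrC invfM mulrA ltrD2l.
by rewrite (lt_trans _ ltr01)// oppr_lt0 invr_gt0.
Qed.
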